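(* Let $n$ be a positive integer. Among all homogeneous strongly log-concave polynomials $p \in \mathbb{R}_{\geq 0}[x_1,\ldots,x_n]$ such that $p(\boldsymbol{1}) = 1$ and $\nabla p(\boldsymbol{1}) = \boldsymbol{1}$, the coefficient of $x_1 x_2 \cdots x_n$ in $p$ is uniquely minimized by $p(\boldsymbol{x}) = \left(\frac{x_1 + \cdots + x_n}{n}\right)^n$.
   Context: $\mathbb{R}_{\geq 0}[x_1,\ldots,x_n]$ denotes polynomials with non-negative real coefficients, and $\boldsymbol{1}$ is the all-ones vector in $\mathbb{R}^n$. A homogeneous polynomial $p \in \mathbb{R}_{\geq 0}[x_1,\ldots,x_n]$ is strongly log-concave (SLC) if for every $\boldsymbol\alpha \in \mathbb{Z}_{\geq 0}^n$ the polynomial $\partial_{x_1}^{\alpha_1} \cdots \partial_{x_n}^{\alpha_n} p$ is either identically zero or log-concave on $\mathbb{R}_{>0}^n$ (i.e. its logarithm is a concave function on $\mathbb{R}_{>0}^n$). (The conditions $p(\boldsymbol{1})=1$, $\nabla p(\boldsymbol{1})=\boldsymbol{1}$ force $p$ to be homogeneous of degree $n$.) *)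

(* Defs.v *)
From mathcomp Require Import all_boot all_order all_algebra.
From mathcomp Require Import mpoly.
From mathcomp Require Import boolp classical_sets reals exp convex.

Set Implicit Arguments.
Unset Strict Implicit.
Unset Printing Implicit Defensive.

Import Order.TTheory GRing.Theory Num.Theory.

Local Open Scope classical_set_scope.
Local Open Scope ring_scope.

Definition positive_orthant (R : realType) (n : nat) : set 'rV[R]_n :=
  [set x | forall i, 0 < x 0 i].
Arguments positive_orthant : clear implicits.

Definition concave_function (R : realType) (E : lmodType R) (D : set E)
    (f : E -> R) : Prop :=
  convex_function (E := E) D (fun x => - f x).

(* [ln] is a total function, with junk value [0] on nonpositive reals; hence
   the explicit positivity of [f] on [D]. *)
Definition log_concave_on (R : realType) (E : lmodType R) (D : set E)
    (f : E -> R) : Prop :=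
  (forall x, D x -> 0 < f x) /\ concave_function D (fun x => ln (f x)).

(* The zero polynomial counts as homogeneous (of every degree). *)
Definition homogeneous (R : realType) (n : nat) (p : {mpoly R[n]}) : Prop :=
  exists d : nat, p \is d.-homog.

Definition strongly_log_concave (R : realType) (n : nat)
    (p : {mpoly R[n]}) : Prop :=
  [/\ p \is a mpolyOver n Num.nneg,
      homogeneous p
    & forall alpha : 'X_{1..n},
        p^`M[alpha] = 0 \/
        log_concave_on (positive_orthant R n)
          (fun x : 'rV[R]_n => (p^`M[alpha]).@[x 0]) ].

Definition normalized_at_ones (R : realType) (n : nat)
    (p : {mpoly R[n]}) : Prop :=
  p.@[fun=> 1] = 1 /\ forall i : 'I_n, (p^`M(i)).@[fun=> 1] = 1.

Definition mean_power (R : realType) (n : nat) : {mpoly R[n]} :=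
  (n%:R^-1 *: \sum_(i < n) 'X_i) ^+ n.

(* Main.v *)
Require Import Defs.
From mathcomp Require Import all_boot all_order all_algebra.
From mathcomp Require Import mpoly.
From mathcomp Require Import boolp classical_sets reals exp convex.
From mathcomp Require Import interval_inference sequences polyrcf ring lra.

Set Implicit Arguments.
Unset Strict Implicit.
Unset Printing Implicit Defensive.

Import Order.TTheory GRing.Theory Num.Theory.

Local Open Scope ring_scope.

(** Write [f = p ^ (1/d)] for the root of a form [p] of degree [d]. When [p] is
    log-concave, [f] is superadditive, hence concave, on the orthant.

    _The bound._ Suppose that [p] has degree [k+1] in the variables [x_j],
    [j \in S], [#|S| = k+1], and that [p(x) >= C * \prod_(j in S) x_j]. Freeze
    all variables but [x_i] and put [r(a) = p(x + a e_i)] for an [x] with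
    [x_i = 0]. The root of [r] lies below its tangent at [0], so
    [r(a) <= r(0) (1 + c a / (k+1)) ^ (k+1)] with [c = r'(0) / r(0)] (the case
    [r(0) = 0] is easier), while
    [r(a) >= M a] with [M = C * \prod_(j in S :\ i) x_j]. At the [a] that is
    best for the upper estimate this gives
    [r'(0) >= (k / (k+1)) ^ k * M] ([log_concave_axis_bound]). So the derivative
    of [p] in [x_i], restricted to [x_i = 0], satisfies a hypothesis of the same
    shape in one variable less, and strong log-concavity passes to it. Induction
    on [S] ([face_coeff_bound]) multiplies these factors up to [n! / n ^ n]. For a
    normalized [p] the induction can start from [C = 1]: the inequality
    [1 + u <= exp u] yields [p(x) >= \prod_j x_j] ([normalized_prod_le]).

    _Equality._ If the bound is attained, then for every [i] all estimates above
    are equalities along some line in the direction [e_i]: the line contains a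
    point [m] with [p(m) = \prod_j m_j], and on it [p] is the [n]-th power of an
    affine function ([tight_line]). The leading coefficient of that power shows
    that [x_i ^ n] occurs in [p]. As every [x_i ^ n] occurs, the equality case
    of [1 + u <= exp u] forces each [m] to be a multiple of the vector [1]. Hence
    the root [f] agrees with the arithmetic mean on all coordinate lines through
    [1] ([tight_line_normalized]). A superadditive homogeneous function with this
    property is the mean: it is at least the mean because
    [x = \sum_i x_i e_i], and at most the mean because
    [n 1 = e x + \sum_i (1 - e x_i e_i)] for small [e > 0]
    ([tight_normalized_eq]). *)

(** * Polynomials in one real variable near the origin *)

Lemma poly_ge0_at0 (R : realType) (g : {poly R}) :
  (forall t, 0 < t -> t <= 1 -> 0 <= g.[t]) -> 0 <= g.[0].
Proof.
move=> g_ge0; rewrite leNgt; apply/negP => g0_lt0.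
have [d d_gt0 g_close] := @poly_cont R 0 g (- g.[0]) ltac:(by rewrite oppr_gt0).
(* A point of the interval so close to 0 that the sign cannot have changed. *)
pose t := Num.min 1 (d / 2).
have t_gt0 : 0 < t by rewrite lt_min ltr01 divr_gt0.
have t_le1 : t <= 1 by rewrite ge_min lexx.
have t_lt : t < d.
  apply: (@le_lt_trans _ _ (d / 2)); last by lra.
  by rewrite ge_min lexx orbT.
have := g_close t; rewrite subr0 gtr0_norm // => /(_ t_lt) g_close_t.
have gt_ge0 := g_ge0 _ t_gt0 t_le1.
by move: g_close_t; rewrite ger0_norm; lra.
Qed.

(** Dividing [g] by ['X] turns the derivative at [0] into a value at [0]. *)
Lemma deriv_ge0_at0 (R : realType) (g : {poly R}) :
  (forall t, 0 < t -> t <= 1 -> 0 <= g.[t]) -> g.[0] = 0 -> 0 <= g^`().[0].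
Proof.
move=> g_ge0 g0; have /factor_theorem[q gE] : root g 0 by rewrite rootE g0.
suff q0_ge0 : 0 <= q.[0].
  by rewrite gE derivM derivXsubC mulr1 hornerD hornerM hornerXsubC subrr mulr0 add0r.
apply: poly_ge0_at0 => t t_gt0 t_le1.
have := g_ge0 _ t_gt0 t_le1; rewrite gE hornerM hornerXsubC subr0.
by rewrite pmulr_lge0.
Qed.

(** The reciprocals of the positive integers provide as many common values as
    the degree requires. *)
Lemma poly_eq_near0 (R : realType) (g h : {poly R}) :
  (forall t, 0 < t -> t <= 1 -> g.[t] = h.[t]) -> g = h.
Proof.
move=> gh; apply/eqP; rewrite -subr_eq0; apply/eqP.
pose s := [seq (i.+1%:R : R)^-1 | i <- iota 0 (size (g - h))].
apply: (@roots_geq_poly_eq0 _ _ s).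
- apply/allP => t /mapP[i _ ->]; rewrite rootE !hornerE gh ?subrr //.
  by rewrite invf_le1 ?ltr0n // ler1n.
- rewrite map_inj_uniq ?iota_uniq // => i j /invr_inj/eqP.
  by rewrite eqr_nat => /eqP[].
- by rewrite size_map size_iota.
Qed.

(** * Restricting a polynomial to a line *)

Definition line_poly (R : realType) (n : nat) (p : {mpoly R[n]})
    (x v : 'rV[R]_n) : {poly R} :=
  mmap polyC (fun j => (x 0 j)%:P + v 0 j *: 'X) p.

Lemma horner_line_poly (R : realType) (n : nat) (p : {mpoly R[n]})
    (x v : 'rV[R]_n) (t : R) :
  (line_poly p x v).[t] = p.@[(x + t *: v) 0].
Proof.
rewrite /line_poly /mmap mevalE horner_sum; apply: eq_bigr => m _.
rewrite hornerM hornerC; congr (_ * _).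
rewrite /mmap1 horner_prod; apply: eq_bigr => j _.
by rewrite !hornerE !mxE mulrC.
Qed.

(** The chain rule along a line. The polynomials that satisfy it contain the
    constants and the variables and are closed under linear combinations and,
    by the Leibniz rule, under products. *)
Lemma deriv_line_poly (R : realType) (n : nat) (p : {mpoly R[n]})
    (x v : 'rV[R]_n) :
  (line_poly p x v)^`() = \sum_j v 0 j *: line_poly p^`M(j) x v.
Proof.
pose P (q : {mpoly R[n]}) :=
  (line_poly q x v)^`() = \sum_j v 0 j *: line_poly q^`M(j) x v.
have PM q r : P q -> P r -> P (q * r).
  move=> Pq Pr; rewrite /P /line_poly rmorphM derivM Pq Pr mulr_suml mulr_sumr.
  rewrite -big_split; apply: eq_bigr => j _ /=.
  by rewrite mderivM mmapD !rmorphM scalerDr scalerAl scalerAr.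
have P1 : P 1.
  rewrite /P /line_poly -mpolyC1 mmapC derivC big1 // => j _.
  by rewrite mderivC mmap0 scaler0.
have PX j : P 'X_j.
  rewrite /P /line_poly mmapX mmap1U derivD derivC add0r derivZ derivX.
  rewrite (bigD1 j) //= big1 => [|k kj]; last first.
    by rewrite mderivX mnm1E eq_sym (negbTE kj) scale0r mmap0 scaler0.
  by rewrite mderivX mnm1E eqxx scale1r -{1}[U_(j)%MM]add0m addmK mpolyX0 -mpolyC1 mmapC addr0.
elim/mpolyind: p => [|c m q _ _ Pq].
  rewrite /line_poly mmap0 deriv0 big1 // => j _.
  by rewrite mderiv0 mmap0 scaler0.
have Pm : P 'X_[m].
  rewrite mpolyXE_id; apply: (big_ind P) => // j _.
  by elim: (m j) => [|k IHk]; rewrite ?expr0 // exprS; apply: PM.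
rewrite /line_poly mmapD mmapZ derivD deriv_mulC.
rewrite [mmap _ _ 'X_[m]]/(line_poly _ _ _) Pm [X in _ + X]Pq.
rewrite mulr_sumr -big_split; apply: eq_bigr => j _ /=.
rewrite mderivD mderivZ mmapD mmapZ scalerDr; congr (_ + _).
by rewrite scalerAr.
Qed.

Definition axis (R : realType) (n : nat) (i : 'I_n) : 'rV[R]_n := delta_mx 0 i.
Arguments axis {R n} i.

Lemma axisE (R : realType) (n : nat) (i j : 'I_n) :
  (axis i : 'rV[R]_n) 0 j = (i == j)%:R.
Proof. by rewrite mxE eqxx eq_sym. Qed.

Lemma deriv_axis_polyZ (R : realType) (n : nat) (p : {mpoly R[n]})
    (x : 'rV[R]_n) (i : 'I_n) (t : R) :
  (line_poly p x (t *: axis i))^`().[0] = t * p^`M(i).@[x 0].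
Proof.
rewrite deriv_line_poly horner_sum (bigD1 i) //= big1 => [|j ji].
  by rewrite mxE axisE eqxx mulr1 hornerZ horner_line_poly scale0r !addr0.
by rewrite mxE axisE eq_sym (negbTE ji) mulr0 scale0r horner0.
Qed.

Definition nonneg_vec (R : realType) (n : nat) (x : 'rV[R]_n) :=
  forall j, 0 <= x 0 j.

Lemma nonneg_vecD (R : realType) (n : nat) (x y : 'rV[R]_n) :
  nonneg_vec x -> nonneg_vec y -> nonneg_vec (x + y).
Proof. by move=> x0 y0 j; rewrite mxE addr_ge0. Qed.

Lemma nonneg_vecZ (R : realType) (n : nat) (c : R) (x : 'rV[R]_n) :
  0 <= c -> nonneg_vec x -> nonneg_vec (c *: x).
Proof. by move=> c0 x0 j; rewrite mxE mulr_ge0. Qed.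

Lemma nonneg_axis (R : realType) (n : nat) (i : 'I_n) :
  nonneg_vec (axis i : 'rV[R]_n).
Proof. by move=> j; rewrite axisE ler0n. Qed.

Lemma meval_vec0 (R : realType) (n : nat) (p : {mpoly R[n]}) :
  p.@[(0 : 'rV[R]_n) 0] = p@_0.
Proof.
rewrite mevalE [X in _ = X@__]mpolyE raddf_sum /=; apply: eq_bigr => m _.
rewrite mcoeffZ mcoeffX; congr (_ * _).
have [->|m_neq0] := eqVneq m 0%MM.
  by rewrite big1 // => j _; rewrite mnm0E expr0.
have [j mj] : exists j, m j != 0%N.
  apply/existsP; apply: contraNT m_neq0 => /existsPn m0.
  by apply/eqP/mnmP => j; rewrite mnm0E; apply/eqP/negPn/m0.
by rewrite (bigD1 j) //= mxE expr0n (negbTE mj) mul0r.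
Qed.

(** Vanishing on the closed orthant passes to partial derivatives, since it
    forces the restriction to each coordinate line to be the zero polynomial;
    and the iterated derivatives at the origin are the coefficients up to
    factorials. *)
Lemma mpoly_orthant_eq (R : realType) (n : nat) (p q : {mpoly R[n]}) :
  (forall x, nonneg_vec x -> p.@[x 0] = q.@[x 0]) -> p = q.
Proof.
pose Z (r : {mpoly R[n]}) := forall x : 'rV[R]_n, nonneg_vec x -> r.@[x 0] = 0.
have Zderiv r i : Z r -> Z r^`M(i).
  move=> Zr x x_ge0; rewrite -[LHS]mul1r -deriv_axis_polyZ scale1r.
  rewrite (_ : line_poly r x (axis i) = 0) ?deriv0 ?horner0 //.
  apply: poly_eq_near0 => t t_gt0 _; rewrite horner_line_poly horner0.
  by apply: Zr; apply/nonneg_vecD/nonneg_vecZ/nonneg_axis/ltW.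
have Zderivm r m : Z r -> Z r^`M[m].
  move=> Zr; rewrite mderivm_foldr.
  have : forall s : seq 'I_n, Z (foldr (@mderiv n R) r s); last exact.
  by elim=> [|i s IHs] //=; apply: Zderiv.
move=> pq; apply/eqP; rewrite -subr_eq0; apply/eqP/mpolyP => m.
have Zpq : Z (p - q) by move=> x /pq pqx; rewrite mevalB pqx subrr.
have := Zderivm _ m Zpq 0.
rewrite meval_vec0 mcoeff_mderivm addm0 mcoeff0 => /(_ _)/eqP.
rewrite mulrn_eq0 => /(_ _)/orP[]; last by move/eqP.
  by move=> j; rewrite mxE.
by rewrite eqn0Ngt prodn_gt0 // => j; rewrite ffactnn fact_gt0.
Qed.

(** * Homogeneous polynomials with nonnegative coefficients *)

Lemma meval_ge0 (R : realType) (n : nat) (p : {mpoly R[n]}) (x : 'rV[R]_n) :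
  p \is a mpolyOver n Num.nneg -> nonneg_vec x -> 0 <= p.@[x 0].
Proof.
move=> /mpolyOverP p_ge0 x_ge0; rewrite mevalE sumr_ge0 // => m _.
by rewrite mulr_ge0 ?prodr_ge0 // => [|j _]; rewrite ?exprn_ge0 // -nnegrE.
Qed.

Lemma meval_le (R : realType) (n : nat) (p : {mpoly R[n]}) (x y : 'rV[R]_n) :
  p \is a mpolyOver n Num.nneg -> nonneg_vec x -> nonneg_vec y ->
  p.@[x 0] <= p.@[(x + y) 0].
Proof.
move=> /mpolyOverP p_ge0 x_ge0 y_ge0; rewrite !mevalE ler_sum // => m _.
apply: ler_wpM2l; first by rewrite -nnegrE.
apply: ler_prod => j _; rewrite exprn_ge0 //= lerXn2r ?nnegrE //.
  by rewrite nonneg_vecD.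
by rewrite mxE lerDl.
Qed.

Lemma meval_homogZ (R : realType) (n d : nat) (p : {mpoly R[n]}) (c : R)
    (x : 'rV[R]_n) :
  p \is d.-homog -> p.@[(c *: x) 0] = c ^+ d * p.@[x 0].
Proof.
move=> /dhomogP p_homog; rewrite !mevalE mulr_sumr !big_seq.
apply: eq_bigr => m m_p; rewrite mulrCA; congr (_ * _).
under eq_bigr do rewrite mxE exprMn.
rewrite big_split; congr (_ * _).
by rewrite -(p_homog m m_p) /mdeg -prodrXr big_tuple; apply: eq_bigr.
Qed.

Lemma meval_homog0 (R : realType) (n d : nat) (p : {mpoly R[n]}) :
  p \is d.+1.-homog -> p.@[(0 : 'rV[R]_n) 0] = 0.
Proof. by move/(meval_homogZ 0 0); rewrite scale0r expr0n mul0r. Qed.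

Lemma mderiv_homog (R : realType) (n d : nat) (p : {mpoly R[n]}) (i : 'I_n) :
  p \is d.+1.-homog -> p^`M(i) \is d.-homog.
Proof.
move=> /dhomogP p_homog; apply/dhomogP => m.
rewrite mcoeff_msupp mcoeff_deriv mulrn_eq0 /= -mcoeff_msupp => /p_homog /=.
by rewrite mdegD mdeg1 addn1 => -[].
Qed.

Lemma slc_nneg (R : realType) (n : nat) (p : {mpoly R[n]}) :
  strongly_log_concave p -> p \is a mpolyOver n Num.nneg.
Proof. by case. Qed.

Lemma slc_mderiv (R : realType) (n : nat) (p : {mpoly R[n]}) (i : 'I_n) :
  strongly_log_concave p -> strongly_log_concave p^`M(i).
Proof.
case=> /mpolyOverP p_ge0 [d p_homog] p_slc; split.
- by apply/mpolyOverP => m; rewrite mcoeff_deriv rpredMn.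
- case: d p_homog => [|d] p_homog; last by exists d; apply: mderiv_homog.
  exists 0%N; apply/dhomogP => m.
  rewrite mcoeff_msupp mcoeff_deriv mulrn_eq0 /= -mcoeff_msupp.
  by move/dhomogP: p_homog => /[apply] /=; rewrite mdegD mdeg1 addn1.
- by move=> alpha; have := p_slc (U_(i) + alpha)%MM; rewrite mderivmDm mderivmU1m.
Qed.

(** * Superadditivity of the root of a log-concave form *)

(** The exponent uses the total inverse, so the name is only meaningful for
    [0 < d] and a nonnegative value of [p] at [x]. *)
Definition form_root (R : realType) (n d : nat) (p : {mpoly R[n]})
    (x : 'rV[R]_n) : R := p.@[x 0] `^ d%:R^-1.

Lemma form_root_ge0 (R : realType) (n d : nat) (p : {mpoly R[n]})
    (x : 'rV[R]_n) : 0 <= form_root d p x.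
Proof. exact: powR_ge0. Qed.

Lemma form_rootK (R : realType) (n d : nat) (p : {mpoly R[n]})
    (x : 'rV[R]_n) :
  p \is a mpolyOver n Num.nneg -> nonneg_vec x -> (0 < d)%N ->
  form_root d p x ^+ d = p.@[x 0].
Proof.
move=> p_ge0 x_ge0 d_gt0.
rewrite /form_root -powR_mulrn ?powR_ge0 // -powRrM mulVf ?pnatr_eq0 -?lt0n //.
by rewrite powRr1 // meval_ge0.
Qed.

(** Rescaling [x] and [y] by the roots of their values puts both on the level set
    [p = 1]; log-concavity says that a convex combination of two points of the
    level set has value at least [1], and with weights [u / (u + v)] and
    [v / (u + v)] that combination is a multiple of [x + y]. *)
Lemma log_concave_superadditive (R : realType) (n d : nat) (p : {mpoly R[n]})
    (x y : 'rV[R]_n) (u v : R) :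
  p \is d.-homog ->
  log_concave_on (positive_orthant R n) (fun z : 'rV[R]_n => p.@[z 0]) ->
  positive_orthant R n x -> positive_orthant R n y -> 0 < u -> 0 < v ->
  u ^+ d = p.@[x 0] -> v ^+ d = p.@[y 0] -> (u + v) ^+ d <= p.@[(x + y) 0].
Proof.
move=> p_homog [p_gt0 p_conc] x_gt0 y_gt0 u_gt0 v_gt0 ux vy.
have uv_gt0 : 0 < u + v by rewrite addr_gt0.
have t_ge0 : 0 <= u / (u + v) by rewrite divr_ge0 ?ltW.
have t_le1 : u / (u + v) <= 1 by rewrite ler_pdivrMr // mul1r lerDl ltW.
have posZ (c : R) (z : 'rV[R]_n) : 0 < c -> positive_orthant R n z ->
    positive_orthant R n (c *: z).
  by move=> c_gt0 z_gt0 j; rewrite mxE mulr_gt0.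
have lnZ (w : R) (z : 'rV[R]_n) : 0 < w -> w ^+ d = p.@[z 0] ->
    ln p.@[(w^-1 *: z) 0] = 0.
  move=> w_gt0 wz; rewrite (meval_homogZ _ _ p_homog) -wz exprVn mulVf ?ln1 //.
  by rewrite expf_neq0 // gt_eqF.
have := p_conc (Itv01 t_ge0 t_le1) (u^-1 *: x) (v^-1 *: y).
rewrite !inE => /(_ (posZ _ _ _ x_gt0) (posZ _ _ _ y_gt0)).
rewrite !invr_gt0 => /(_ u_gt0 v_gt0); rewrite !lnZ //.
have -> : conv (Itv01 t_ge0 t_le1) (u^-1 *: x : convex_lmodType 'rV[R]_n)
    (v^-1 *: y) = (u + v)^-1 *: (x + y).
  transitivity ((u / (u + v)) *: (u^-1 *: x) +
                (1 - u / (u + v)) *: (v^-1 *: y)); first by [].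
  rewrite !scalerA scalerDr; congr (_ *: _ + _ *: _); first by field; lra.
  by field; lra.
rewrite convRE !oppr0 !mulr0 addr0 lerNl oppr0 => ln_ge0_xy.
have z_gt0 : 0 < p.@[((u + v)^-1 *: (x + y)) 0].
  apply: p_gt0; apply: posZ; first by rewrite invr_gt0.
  by move=> j; rewrite mxE addr_gt0.
move: ln_ge0_xy; rewrite -ln1 ler_ln ?posrE //.
rewrite (meval_homogZ _ _ p_homog) exprVn mulrC ler_pdivlMr ?mul1r //.
by rewrite exprn_gt0.
Qed.

(** Roots taken at interior points close to the boundary dominate the roots at
    the boundary, because the coefficients are nonnegative; so superadditivity at
    interior points passes to the closed orthant by continuity. *)
Lemma form_rootD (R : realType) (n d : nat) (p : {mpoly R[n]})
    (x y : 'rV[R]_n) :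
  strongly_log_concave p -> p \is d.-homog -> (0 < d)%N ->
  nonneg_vec x -> nonneg_vec y ->
  form_root d p x + form_root d p y <= form_root d p (x + y).
Proof.
move=> p_slc p_homog d_gt0 x_ge0 y_ge0; have p_ge0 := slc_nneg p_slc.
rewrite -(@ler_pXn2r _ d) ?nnegrE ?addr_ge0 ?form_root_ge0 //.
rewrite [leRHS]form_rootK //; last exact: nonneg_vecD.
have [p_eq0|p_conc] : p = 0 \/
    log_concave_on (positive_orthant R n) (fun z : 'rV[R]_n => p.@[z 0]).
  by have [_ _ /(_ 0%MM)] := p_slc; rewrite mderivm0m.
  rewrite /form_root p_eq0 !meval0 powR0 ?invr_eq0 ?pnatr_eq0 -?lt0n //.
  by rewrite addr0 expr0n gtn_eqF.
pose one : 'rV[R]_n := const_mx 1.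
pose c := (form_root d p x + form_root d p y) ^+ d.
suff : 0 <= (line_poly p (x + y) (2 *: one) - c%:P).[0].
  by rewrite hornerD hornerN hornerC horner_line_poly scale0r addr0 subr_ge0.
apply: poly_ge0_at0 => e e_gt0 _.
rewrite hornerD hornerN hornerC horner_line_poly subr_ge0.
have one_ge0 : nonneg_vec (e *: one) by move=> j; rewrite !mxE mulr1 ltW.
have pos (z : 'rV[R]_n) : nonneg_vec z -> positive_orthant R n (z + e *: one).
  by move=> z_ge0 j; rewrite !mxE mulr1 ltr_wpDl.
have root_gt0 (z : 'rV[R]_n) : nonneg_vec z -> 0 < form_root d p (z + e *: one).
  by move=> z_ge0; apply/powR_gt0/(proj1 p_conc)/pos.
have root_le (z : 'rV[R]_n) : nonneg_vec z ->
    form_root d p z <= form_root d p (z + e *: one).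
  move=> z_ge0; apply: ge0_ler_powR; rewrite ?nnegrE ?invr_ge0 ?meval_ge0 //.
    exact: nonneg_vecD.
  exact: meval_le.
have -> : x + y + e *: (2 *: one) = (x + e *: one) + (y + e *: one).
  by apply/rowP => j; rewrite !mxE; ring.
apply: (@le_trans _ _
  ((form_root d p (x + e *: one) + form_root d p (y + e *: one)) ^+ d)).
  rewrite lerXn2r ?nnegrE ?addr_ge0 ?form_root_ge0 //.
  by apply: lerD; apply: root_le.
apply: log_concave_superadditive => //; try exact: pos; try exact: root_gt0.
  by rewrite form_rootK //; apply: nonneg_vecD.
by rewrite form_rootK //; apply: nonneg_vecD.
Qed.

Lemma form_rootZ (R : realType) (n d : nat) (p : {mpoly R[n]}) (c : R)
    (x : 'rV[R]_n) :
  p \is a mpolyOver n Num.nneg -> p \is d.-homog -> (0 < d)%N ->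
  0 <= c -> nonneg_vec x -> form_root d p (c *: x) = c * form_root d p x.
Proof.
move=> p_ge0 p_homog d_gt0 c_ge0 x_ge0; apply/eqP.
rewrite -(@eqrXn2 _ d) ?mulr_ge0 ?form_root_ge0 //.
rewrite exprMn !form_rootK //; last exact: nonneg_vecZ.
by rewrite (meval_homogZ _ _ p_homog).
Qed.

Lemma form_root_eq (R : realType) (n d : nat) (p : {mpoly R[n]}) (u : R)
    (x : 'rV[R]_n) :
  (0 < d)%N -> 0 <= u -> p.@[x 0] = u ^+ d -> form_root d p x = u.
Proof.
move=> d_gt0 u_ge0 pxu; rewrite /form_root pxu -powR_mulrn // -powRrM.
by rewrite mulfV ?pnatr_eq0 -?lt0n // powRr1.
Qed.

(** Concavity of [form_root d p] on the segment from [x] to [x + t *: axis i],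
    differentiated at [x]. Multiplying out the denominator [r ^+ d.-1] keeps the
    inequality meaningful where the root vanishes. *)
Lemma form_root_tangent (R : realType) (n d : nat) (p : {mpoly R[n]})
    (x : 'rV[R]_n) (i : 'I_n) (t : R) :
  strongly_log_concave p -> p \is d.-homog -> (0 < d)%N ->
  nonneg_vec x -> 0 <= t ->
  d%:R * form_root d p x ^+ d.-1 * form_root d p (x + t *: axis i) <=
  d%:R * form_root d p x ^+ d + t * p^`M(i).@[x 0].
Proof.
move=> p_slc p_homog d_gt0 x_ge0 t_ge0; have p_ge0 := slc_nneg p_slc.
set r := form_root d p x; set s := form_root d p (x + t *: axis i).
have y_ge0 : nonneg_vec (x + t *: axis i).
  exact/nonneg_vecD/nonneg_vecZ/nonneg_axis.
pose g := line_poly p x (t *: axis i) - (r%:P + (s - r) *: 'X) ^+ d.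
have g0 : g.[0] = 0.
  rewrite /g hornerD hornerN horner_line_poly scale0r addr0.
  by rewrite horner_exp !hornerE /= form_rootK ?subrr.
have g_ge0 e : 0 < e -> e <= 1 -> 0 <= g.[e].
  move=> e_gt0 e_le1; rewrite /g hornerD hornerN horner_line_poly.
  rewrite subr_ge0 horner_exp !hornerE /=.
  have -> : x + e *: (t *: axis i) = (1 - e) *: x + e *: (x + t *: axis i).
    by rewrite scalerDr addrA -scalerDl subrK scale1r.
  have e'_ge0 : 0 <= 1 - e by rewrite subr_ge0.
  have -> : r + (s - r) * e = (1 - e) * r + e * s by ring.
  have e_ge0 := ltW e_gt0.
  rewrite -!form_rootZ // -[leRHS](@form_rootK _ _ d) //; last first.
    by apply: nonneg_vecD; apply: nonneg_vecZ.
  rewrite lerXn2r ?nnegrE ?addr_ge0 ?form_root_ge0 //.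
  by apply: form_rootD => //; apply: nonneg_vecZ.
have := deriv_ge0_at0 g_ge0 g0.
rewrite /g derivB hornerD hornerN deriv_axis_polyZ deriv_exp.
rewrite derivD derivC add0r derivZ derivX hornerMn hornerM hornerZ hornerC.
rewrite horner_exp hornerD hornerC hornerZ hornerX mulr0 addr0 mulr1.
rewrite -(prednK d_gt0) /= [r ^+ _.+1]exprS -mulr_natl -(prednK d_gt0) /=.
lra.
Qed.

(** * Eliminating one variable *)

(** Where the root vanishes the tangent inequality carries no information (in
    degree at least [2]), but then the lower bound [M * t] has the same value at [t = 0] as the polynomial,
    which gives an estimate without any loss. *)
Lemma mderiv_ge_axis_slope (R : realType) (n : nat) (p : {mpoly R[n]})
    (x : 'rV[R]_n) (i : 'I_n) (M : R) :
  p.@[x 0] = 0 ->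
  (forall t, 0 < t -> M * t <= p.@[(x + t *: axis i) 0]) ->
  M <= p^`M(i).@[x 0].
Proof.
move=> px0 p_ge; pose g := line_poly p x (1 *: axis i) - M *: 'X.
have g_ge0 t : 0 < t -> t <= 1 -> 0 <= g.[t].
  move=> t_gt0 _; rewrite hornerD hornerN horner_line_poly hornerZ hornerX.
  by rewrite subr_ge0 scale1r p_ge.
have g0 : g.[0] = 0.
  by rewrite hornerD hornerN horner_line_poly hornerZ hornerX scale0r mulr0
    subr0 addr0.
have := deriv_ge0_at0 g_ge0 g0.
rewrite derivB hornerD hornerN deriv_axis_polyZ derivZ derivX.
by rewrite hornerZ hornerC mul1r mulr1 subr_ge0.
Qed.

(** The two parts are the loss of a factor [(k / (k+1)) ^ k] when passing from
    the slope [M] of a lower bound along the axis to the derivative at [x], and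
    the shape of [p] on that line when the loss is exactly this factor: there the
    lower bound is attained at some [t], and [p] is a power of an affine function
    whose value at [0] is [k] times its increment between [0] and [t]. *)
Definition axis_derivative_bound (R : realType) (n k : nat) (p : {mpoly R[n]})
    (x : 'rV[R]_n) (i : 'I_n) (M : R) :=
  M * k%:R ^+ k <= k.+1%:R ^+ k * p^`M(i).@[x 0] /\
  (k.+1%:R ^+ k * p^`M(i).@[x 0] = M * k%:R ^+ k ->
   exists t s, [/\ 0 < t, 0 < s, p.@[(x + t *: axis i) 0] = M * t &
     forall a, 0 <= a ->
       p.@[(x + a *: axis i) 0] = (k%:R * s * t + s * a) ^+ k.+1]).

(** With [r] and [B] the root and the derivative at [x], the tangent inequality
    bounds the polynomial on the line by
    [(r + t * B / ((k+1) * r ^+ k)) ^+ k.+1]. The ratio of this bound to [t] is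
    smallest at [t = (k+1) r ^ (k+1) / (k B)], where the root of the bound is
    [r (k+1) / k]; comparing with [M * t] there gives the inequality. In the
    equality case the root meets its tangent at this [t], so by concavity it is
    affine between [0] and [t], and a polynomial identity on an interval holds
    everywhere. *)
Lemma log_concave_axis_bound (R : realType) (n k : nat) (p : {mpoly R[n]})
    (x : 'rV[R]_n) (i : 'I_n) (M : R) :
  strongly_log_concave p -> p \is k.+1.-homog -> nonneg_vec x -> 0 < M ->
  (k = 0%N -> p.@[x 0] = 0) ->
  (forall t, 0 < t -> M * t <= p.@[(x + t *: axis i) 0]) ->
  axis_derivative_bound k p x i M.
Proof.
move=> p_slc p_homog x_ge0 M_gt0 p0 p_ge; have p_ge0 := slc_nneg p_slc.
have y_ge0 t : 0 <= t -> nonneg_vec (x + t *: axis i).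
  by move=> t_ge0; apply/nonneg_vecD/nonneg_vecZ/nonneg_axis.
have tangent t := @form_root_tangent R n k.+1 p x i t p_slc p_homog isT x_ge0.
have rE : form_root k.+1 p x ^+ k.+1 = p.@[x 0] by exact: form_rootK.
have rhoE t : 0 <= t ->
    form_root k.+1 p (x + t *: axis i) ^+ k.+1 = p.@[(x + t *: axis i) 0].
  by move=> t_ge0; apply: form_rootK => //; apply: y_ge0.
(* A vanishing root forces equality to fail unless k = 0. *)
have := form_root_ge0 k.+1 p x; rewrite le_eqVlt => /predU1P[r0|].
  have px0 : p.@[x 0] = 0 by rewrite -rE -r0 expr0n.
  have MB := mderiv_ge_axis_slope px0 p_ge.
  case: k => [|k] in p_slc p_homog p0 tangent rE rhoE r0 *.
    split=> [|]; rewrite !expr0 mulr1 mul1r // => BM.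
    have pt t : 0 <= t -> p.@[(x + t *: axis i) 0] = M * t.
      rewrite le_eqVlt => /predU1P[<-|t_gt0]; first by rewrite scale0r addr0 px0 mulr0.
      have t_ge0 := ltW t_gt0.
      apply/eqP; rewrite eq_le p_ge // andbT -rhoE //.
      have := tangent t (ltW t_gt0).
      by rewrite rE px0 BM /= !expr0 !expr1 !mul1r ?add0r mulrC.
    exists 1, M; split; rewrite ?pt // => a a_ge0.
    by rewrite pt // !mul0r add0r expr1.
  have B_gt0 : 0 < p^`M(i).@[x 0] by apply: lt_le_trans M_gt0 _.
  have lt_pow : M * k.+1%:R ^+ k.+1 < k.+2%:R ^+ k.+1 * p^`M(i).@[x 0].
    rewrite mulrC; apply: (@lt_le_trans _ _ (k.+2%:R ^+ k.+1 * M)).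
      by rewrite ltr_pM2r // ltrXn2r ?ler0n // ltr_nat.
    by rewrite ler_wpM2l // exprn_ge0.
  by split=> [|eqM]; [apply: ltW | move: lt_pow; rewrite eqM ltxx].
move: tangent rE rhoE; set r := form_root _ _ x; set B := p^`M(i).@[x 0].
move=> tangent rE rhoE r_gt0.
case: k => [|k'] in p_slc p_homog p0 r tangent rE rhoE r_gt0 *.
  by move: r_gt0; rewrite -[r]expr1 rE p0 // ltxx.
set k := k'.+1 in p_slc p_homog p0 r tangent rE rhoE r_gt0 *.
have k_gt0 : 0 < k%:R :> R by rewrite ltr0n.
have kS : k.+1%:R = k%:R + 1 :> R by rewrite -natr1.
have d_gt0 : 0 < k.+1%:R :> R by rewrite ltr0n.
have rk_gt0 : 0 < r ^+ k by rewrite exprn_gt0.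
have rd_gt0 : 0 < r ^+ k.+1 by rewrite exprn_gt0.
have B_gt0 : 0 < B.
  rewrite ltNge; apply/negP => B_le0.
  (* Otherwise p is bounded by r ^+ k.+1 on the line, but M * t exceeds it. *)
  pose t := (r ^+ k.+1 + 1) / M.
  have t_gt0 : 0 < t by rewrite divr_gt0 // addr_gt0.
  have t_ge0 := ltW t_gt0.
  have : form_root k.+1 p (x + t *: axis i) <= r.
    rewrite -(@ler_pM2l _ (k.+1%:R * r ^+ k)) ?mulr_gt0 //.
    apply: le_trans (tangent t (ltW t_gt0)) _; rewrite -/r -/B.
    rewrite [r ^+ k.+1]exprSr mulrA gerDl mulr_ge0_le0 //.
  move/(lerXn2r k.+1); rewrite ?nnegrE ?form_root_ge0 ?(ltW r_gt0) // => /(_ isT isT).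
  rewrite rhoE // leNgt => /negP; apply.
  apply: lt_le_trans (p_ge t t_gt0).
  by rewrite /t mulrC divfK ?gt_eqF // ltrDl.
(* The minimizer of the ratio of the tangent bound to t. *)
pose t := k.+1%:R * r ^+ k.+1 / (k%:R * B).
have t_gt0 : 0 < t by rewrite divr_gt0 // mulr_gt0.
have t_ge0 := ltW t_gt0.
have tB : t * B = k.+1%:R * r ^+ k.+1 / k%:R by rewrite /t; field; lra.
have rho_le : form_root k.+1 p (x + t *: axis i) <= r * (k.+1%:R / k%:R).
  rewrite -(@ler_pM2l _ (k.+1%:R * r ^+ k)) ?mulr_gt0 //.
  apply: le_trans (tangent t (ltW t_gt0)) _; rewrite -/r -/B tB.
  by rewrite le_eqVlt exprS kS; apply/orP; left; apply/eqP; field; lra.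
have q_gt0 : 0 < k.+1%:R / k%:R :> R by rewrite divr_gt0.
have q_ge0 := ltW q_gt0.
have pt_le : p.@[(x + t *: axis i) 0] <= (r * (k.+1%:R / k%:R)) ^+ k.+1.
  rewrite -rhoE //; apply: lerXn2r => //; rewrite nnegrE ?form_root_ge0 //.
  by rewrite mulr_ge0 // (ltW r_gt0).
have tM : M * t <= (r * (k.+1%:R / k%:R)) ^+ k.+1 by apply: le_trans pt_le; apply: p_ge.
(* Up to a positive factor, the defect of the claimed inequality is the defect
   of the estimate of M * t; so both vanish together. *)
have scaleE : (k%:R ^+ k.+1 * B / (r ^+ k.+1 * k.+1%:R)) *
    ((r * (k.+1%:R / k%:R)) ^+ k.+1 - M * t) =
    k.+1%:R ^+ k * B - M * k%:R ^+ k.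
  rewrite /t !exprMn !exprVn !exprS; field.
  by rewrite !expf_neq0 ?gt_eqF //.
have fac_gt0 : 0 < k%:R ^+ k.+1 * B / (r ^+ k.+1 * k.+1%:R).
  by apply: divr_gt0; apply: mulr_gt0 => //; rewrite exprn_gt0.
split=> [|eqM].
  by rewrite -subr_ge0 -/B -scaleE mulr_ge0 ?(ltW fac_gt0) // subr_ge0.
move: scaleE; rewrite -/B in eqM; rewrite eqM subrr => /eqP.
rewrite mulf_eq0 gt_eqF //= subr_eq0 => /eqP tME.
have ptE : p.@[(x + t *: axis i) 0] = M * t.
  by apply/eqP; rewrite eq_le p_ge // andbT -tME.
have rhotE : form_root k.+1 p (x + t *: axis i) = r * (k.+1%:R / k%:R).
  apply: form_root_eq => //; last by rewrite ptE tME.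
  by rewrite mulr_ge0 // (ltW r_gt0).
pose s := r / (k%:R * t).
have s_gt0 : 0 < s by rewrite divr_gt0 // mulr_gt0.
have rs : k%:R * s * t = r by rewrite /s; field; lra.
exists t, s; split=> //.
pose h := (r%:P + (s * t) *: 'X) ^+ k.+1.
have hE e : h.[e] = (r + s * t * e) ^+ k.+1.
  by rewrite horner_exp hornerD hornerC hornerZ hornerX.
have lineE : line_poly p x (t *: axis i) = h.
  apply: poly_eq_near0 => e e_gt0 e_le1; rewrite horner_line_poly hE scalerA.
  have [e_ge0 s_ge0 r_ge0] := And3 (ltW e_gt0) (ltW s_gt0) (ltW r_gt0).
  have et_ge0 : 0 <= e * t by rewrite mulr_ge0.
  have ste_ge0 : 0 <= r + s * t * e.
    by apply: addr_ge0 => //; apply: mulr_ge0 => //; apply: mulr_ge0.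
  rewrite -rhoE //; apply/eqP; rewrite eqrXn2 ?form_root_ge0 // eq_le.
  apply/andP; split.
    rewrite -(@ler_pM2l _ (k.+1%:R * r ^+ k)) ?mulr_gt0 //.
    apply: le_trans (tangent _ et_ge0) _; rewrite -/r -/B -(mulrA e) tB.
    rewrite le_eqVlt exprS /s; apply/orP; left; apply/eqP; field; lra.
  have -> : x + (e * t) *: axis i = (1 - e) *: x + e *: (x + t *: axis i).
    by rewrite scalerDr scalerA addrA -scalerDl subrK scale1r.
  have e'_ge0 : 0 <= 1 - e by rewrite subr_ge0.
  have ty_ge0 := y_ge0 t (ltW t_gt0).
  apply: le_trans (form_rootD p_slc p_homog isT (nonneg_vecZ _ _) (nonneg_vecZ _ _)) => //.
  rewrite !form_rootZ // rhotE -/r.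
  rewrite le_eqVlt kS /s; apply/orP; left; apply/eqP; field; lra.
move=> a a_ge0; rewrite rs.
have := congr1 (fun g => g.[a / t]) lineE.
rewrite /= horner_line_poly hE scalerA divfK ?gt_eqF // => ->.
by congr (_ ^+ _); field; lra.
Qed.

(** * The coefficient bound on a face of the orthant *)

(** The relative interior of the face of the orthant spanned by [S]. Working on
    faces keeps the number of variables fixed during the induction. *)
Definition face_interior (R : realType) (n : nat) (S : {set 'I_n})
    (x : 'rV[R]_n) :=
  forall j, if j \in S then is_true (0 < x 0 j) else x 0 j = 0.

Lemma face_interior_nonneg (R : realType) (n : nat) (S : {set 'I_n})
    (x : 'rV[R]_n) : face_interior S x -> nonneg_vec x.
Proof. by move=> xS j; have := xS j; case: ifP => _ => [/ltW|->]. Qed.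

Lemma face_interiorD1 (R : realType) (n : nat) (S : {set 'I_n}) (i : 'I_n)
    (x : 'rV[R]_n) (t : R) :
  i \in S -> 0 < t -> face_interior (S :\ i) x ->
  face_interior S (x + t *: axis i).
Proof.
move=> iS t_gt0 xS j; rewrite !mxE eqxx /=; have := xS j; rewrite !inE.
have [->|ji] /= := eqVneq j i; first by rewrite iS mulr1 => ->; rewrite add0r.
by rewrite mulr0 addr0.
Qed.

Lemma face_prodD1 (R : realType) (n : nat) (S : {set 'I_n}) (i : 'I_n)
    (x : 'rV[R]_n) (t : R) :
  i \in S -> face_interior (S :\ i) x ->
  \prod_(j in S) (x + t *: axis i) 0 j = t * \prod_(j in S :\ i) x 0 j.
Proof.
move=> iS xS; rewrite (big_setD1 i iS) /=; congr (_ * _).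
  by have := xS i; rewrite !inE eqxx /= !mxE !eqxx mulr1 => ->; rewrite add0r.
apply: eq_bigr => j; rewrite !inE !mxE eqxx /= => /andP[/negbTE-> _].
by rewrite mulr0 addr0.
Qed.

Definition face_monom (n : nat) (S : {set 'I_n}) : 'X_{1..n} :=
  [multinom (i \in S : nat) | i < n].

Lemma face_monomD1 (n : nat) (S : {set 'I_n}) (i : 'I_n) :
  i \in S -> face_monom S = (face_monom (S :\ i) + U_(i))%MM.
Proof.
move=> iS; apply/mnmP => j; rewrite mnmDE mnm1E !mnmE !inE eq_sym.
by have [<-|_] := eqVneq i j; rewrite ?iS ?addn0.
Qed.

Lemma face_axis_bound (R : realType) (n k : nat) (p : {mpoly R[n]})
    (S : {set 'I_n}) (i : 'I_n) (C : R) (x : 'rV[R]_n) :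
  strongly_log_concave p -> p \is k.+1.-homog -> #|S| = k.+1 -> i \in S ->
  0 < C ->
  (forall y, face_interior S y -> C * \prod_(j in S) y 0 j <= p.@[y 0]) ->
  face_interior (S :\ i) x ->
  axis_derivative_bound k p x i (C * \prod_(j in S :\ i) x 0 j).
Proof.
move=> p_slc p_homog cardS iS C_gt0 p_ge xS.
apply: log_concave_axis_bound => // [|||t t_gt0].
- exact: face_interior_nonneg xS.
- rewrite mulr_gt0 // prodr_gt0 // => j jS; have := xS j.
  by rewrite jS.
- move=> k0; have S0 : S :\ i = finset.set0.
    have := cardsD1 i S; rewrite iS cardS k0 => -[]; rewrite add0n => card0.
    by apply/eqP; rewrite -cards_eq0 -card0.
  have -> : x = 0.
    by apply/rowP => j; have := xS j; rewrite S0 inE mxE.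
  exact: meval_homog0 p_homog.
- have := p_ge _ (face_interiorD1 iS t_gt0 xS).
  by rewrite face_prodD1 // mulrCA mulrC.
Qed.

(** What equality in the bound for the coefficient leaves behind in the direction
    [axis i]. The constant term [k * s * t] says that the root of [p] grows by the
    factor [(k+1) / k] from [x] to the contact point [x + t *: axis i]. *)
Definition tight_line (R : realType) (n k : nat) (p : {mpoly R[n]})
    (S : {set 'I_n}) (C : R) (i : 'I_n) :=
  exists (x : 'rV[R]_n) (t s : R),
    [/\ face_interior (S :\ i) x, 0 < t, 0 < s,
        p.@[(x + t *: axis i) 0] = C * \prod_(j in S) (x + t *: axis i) 0 j
      & forall a, 0 <= a ->
          p.@[(x + a *: axis i) 0] = (k%:R * s * t + s * a) ^+ k.+1].

(** The existence of a point [m] where the hypothesis on [p] is an equality is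
    part of the conclusion because the induction needs it: such a point for the
    derivative in [x_i] is the base point at which equality holds in
    [log_concave_axis_bound] for [p] itself. *)
Lemma face_coeff_bound (R : realType) (n k : nat) (p : {mpoly R[n]})
    (S : {set 'I_n}) (C : R) :
  strongly_log_concave p -> p \is k.-homog -> #|S| = k -> 0 < C ->
  (forall x, face_interior S x -> C * \prod_(j in S) x 0 j <= p.@[x 0]) ->
  C * k`!%:R <= p@_(face_monom S) * k%:R ^+ k /\
  (p@_(face_monom S) * k%:R ^+ k = C * k`!%:R ->
   (exists2 m, face_interior S m & p.@[m 0] = C * \prod_(j in S) m 0 j) /\
   (forall i, i \in S -> tight_line k.-1 p S C i)).
Proof.
elim: k p S C => [|k IHk] p S C p_slc p_homog cardS C_gt0 p_ge.
  have S0 : S = finset.set0 by apply/eqP; rewrite -cards_eq0 cardS.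
  have m0 : face_monom S = 0%MM.
    by apply/mnmP => j; rewrite mnmE mnm0E S0 inE.
  have x0 : face_interior S (0 : 'rV[R]_n).
    by move=> j; rewrite S0 inE mxE.
  have := p_ge _ x0; rewrite meval_vec0 S0 big_set0 -S0 m0 expr0 !mulr1 => p0.
  split=> [//|p0E]; split; last by move=> i; rewrite S0 inE.
  by exists 0 => //; rewrite meval_vec0 S0 big_set0 mulr1.
(* The constant that survives the elimination of one variable. *)
pose C' := C * k%:R ^+ k / k.+1%:R ^+ k.
have kS_gt0 : 0 < k.+1%:R ^+ k :> R by rewrite exprn_gt0 // ltr0n.
have kk_gt0 : 0 < k%:R ^+ k :> R.
  by case: (k) => [|k']; rewrite ?expr0 // exprn_gt0 // ltr0n.
have C'_gt0 : 0 < C' by rewrite divr_gt0 // mulr_gt0.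
have step i : i \in S ->
    C' * k`!%:R <= p@_(face_monom S) * k%:R ^+ k /\
    (p@_(face_monom S) * k%:R ^+ k = C' * k`!%:R -> tight_line k p S C i).
  move=> iS; have cardSi : #|S :\ i| = k.
    by have := cardsD1 i S; rewrite iS cardS => -[].
  have line x := face_axis_bound p_slc p_homog cardS iS C_gt0 p_ge (x := x).
  have q_ge x : face_interior (S :\ i) x ->
      C' * \prod_(j in S :\ i) x 0 j <= p^`M(i).@[x 0].
    move=> xS; have [+ _] := line x xS.
    rewrite mulrC -ler_pdivrMl //; congr (_ <= _).
    by rewrite /C'; field; rewrite gt_eqF.
  have [] := IHk _ _ _ (slc_mderiv i p_slc) (mderiv_homog i p_homog) cardSi
    C'_gt0 q_ge.
  rewrite mcoeff_deriv -face_monomD1 // mnmE !inE eqxx mulr1n => bound tight.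
  split=> // /tight[[x xS qxE] _]; have [_] := line x xS.
  case=> [|t [s [t_gt0 s_gt0 ptE formula]]].
    by rewrite qxE /C'; field; rewrite gt_eqF.
  exists x, t, s; split=> //.
  by rewrite ptE face_prodD1 // mulrAC mulrA.
have [i0 i0S] : exists i, i \in S by apply/card_gt0P; rewrite cardS.
have scale : p@_(face_monom S) * k.+1%:R ^+ k.+1 - C * k.+1`!%:R =
    (k.+1%:R ^+ k.+1 / k%:R ^+ k) *
    (p@_(face_monom S) * k%:R ^+ k - C' * k`!%:R).
  by rewrite /C' factS natrM exprS; field; rewrite !gt_eqF.
have fac_gt0 : 0 < k.+1%:R ^+ k.+1 / k%:R ^+ k :> R.
  by rewrite divr_gt0 // exprn_gt0 // ltr0n.
split=> [|eqC].
  rewrite -subr_ge0 scale; apply: mulr_ge0; first exact: ltW.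
  by rewrite subr_ge0; have [] := step i0 i0S.
have eqC' : p@_(face_monom S) * k%:R ^+ k = C' * k`!%:R.
  apply/eqP; rewrite -subr_eq0; move/eqP: scale.
  by rewrite eqC subrr eq_sym mulf_eq0 gt_eqF.
have tight i (iS : i \in S) : tight_line k p S C i by apply: (step i iS).2.
split=> //; have [x [t [s [xS t_gt0 _ ptE _]]]] := tight i0 i0S.
by exists (x + t *: axis i0) => //; apply: face_interiorD1.
Qed.

(** * The power of the mean *)

Definition mean_form (R : realType) (n : nat) : {mpoly R[n]} :=
  n%:R^-1 *: \sum_(i < n) 'X_i.
Arguments mean_form : clear implicits.

Lemma meval_mean_form (R : realType) (n : nat) (x : 'I_n -> R) :
  (mean_form R n).@[x] = (\sum_i x i) / n%:R.
Proof.
rewrite mevalZ raddf_sum mulrC; congr (_ / _).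
by apply: eq_bigr => i _; rewrite /= mevalXU.
Qed.

Lemma mean_form_homog (R : realType) (n d : nat) :
  mean_form R n ^+ d \is d.-homog.
Proof.
rewrite -[X in X.-homog]mul1n; apply: dhomogMn.
apply: dhomogZ; apply: rpred_sum => i _.
by rewrite dhomogX /= mdeg1.
Qed.

Lemma mean_form_nneg (R : realType) (n d : nat) :
  mean_form R n ^+ d \is a mpolyOver n Num.nneg.
Proof.
elim: d => [|d /mpolyOverP IHd].
  by apply/mpolyOverP => m; rewrite expr0 mcoeff1 nnegrE.
apply/mpolyOverP => m; rewrite exprS nnegrE mcoeffM sumr_ge0 // => ab _.
apply: mulr_ge0; last by rewrite -nnegrE.
rewrite mcoeffZ raddf_sum /= mulr_ge0 // sumr_ge0 // => i _.
by rewrite mcoeffX.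
Qed.

Lemma mderiv_mean_form (R : realType) (n d : nat) (i : 'I_n) :
  (mean_form R n ^+ d)^`M(i) = (d%:R / n%:R) *: mean_form R n ^+ d.-1.
Proof.
have deriv1 : (mean_form R n)^`M(i) = (n%:R^-1)%:MP.
  rewrite mderivZ -mul_mpolyC [X in _ * X](_ : _ = 1) ?mulr1 //.
  transitivity (\sum_(j < n) (j == i)%:R : {mpoly R[n]}).
    rewrite linear_sum; apply: eq_bigr => j _.
    rewrite /= mderivX mnm1E; have [->|_] := eqVneq j i; last by rewrite scale0r.
    by rewrite scale1r -{1}[U_(i)%MM]add0m addmK mpolyX0.
  by rewrite (bigD1 i) //= eqxx big1 ?addr0 // => j /negbTE->.
elim: d => [|d IHd]; first by rewrite expr0 -mpolyC1 mderivC mul0r scale0r.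
rewrite exprS mderivM IHd deriv1 mul_mpolyC -scalerAr -exprS.
case: d {IHd} => [|d].
  by rewrite mul0r scale0r addr0 mul1r.
by rewrite /= -scalerDl; congr (_ *: _); rewrite -(natr1 d.+1); ring.
Qed.

Lemma mderivm_mean_form (R : realType) (n d : nat) (m : 'X_{1..n}) :
  (mean_form R n ^+ d)^`M[m] =
  ((d ^_ mdeg m)%:R / n%:R ^+ mdeg m) *: mean_form R n ^+ (d - mdeg m).
Proof.
rewrite mderivm_foldr.
set s := flatten _.
have -> : mdeg m = size s.
  rewrite size_flatten /shape -map_comp mdegE sumnE big_map enumT.
  by apply: eq_bigr => i _; rewrite /= size_nseq.
elim: s => [|i s IHs] /=; first by rewrite expr0 divr1 scale1r subn0.
rewrite IHs mderivZ mderiv_mean_form scalerA subnS; congr (_ *: _).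
by rewrite ffactnSr natrM exprSr invfM; ring.
Qed.

(** Every derivative is a nonnegative multiple of a power of the mean, and the
    logarithm of a linear form is concave where the form is positive. *)
Lemma mean_power_slc (R : realType) (n : nat) :
  (0 < n)%N -> strongly_log_concave (mean_power R n).
Proof.
move=> n_gt0; split.
- exact: mean_form_nneg.
- by exists n; apply: mean_form_homog.
move=> alpha; rewrite mderivm_mean_form.
set c := _ / _; set e := (n - _)%N.
have : 0 <= c by rewrite divr_ge0.
rewrite le_eqVlt => /predU1P[<-|c_gt0]; [left | right]; first by rewrite scale0r.
have mean_gt0 (x : 'rV[R]_n) :
    positive_orthant R n x -> 0 < (mean_form R n).@[x 0].
  move=> x_gt0; rewrite meval_mean_form divr_gt0 ?ltr0n //.
  rewrite (bigD1 (Ordinal n_gt0)) //= ltr_wpDr // sumr_ge0 // => i _.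
  exact/ltW.
have formE (x : 'rV[R]_n) :
    (c *: mean_form R n ^+ e).@[x 0] = c * (mean_form R n).@[x 0] ^+ e.
  by rewrite mevalZ rmorphXn.
have lnE (x : 'rV[R]_n) : positive_orthant R n x ->
    ln (c *: mean_form R n ^+ e).@[x 0] = ln c + e%:R * ln (mean_form R n).@[x 0].
  move=> x_gt0; rewrite formE lnM ?posrE ?exprn_gt0 ?mean_gt0 // lnXn ?mean_gt0 //.
  by rewrite mulr_natl.
split=> [x x_gt0|t x y]; first by rewrite formE mulr_gt0 // exprn_gt0 // mean_gt0.
rewrite !inE => x_gt0 y_gt0; rewrite -convN lerN2.
have zE : conv t (x : convex_lmodType 'rV[R]_n) y =
    t%:inum *: x + (1 - t%:inum) *: y by [].
have convE (a b : R^o) : conv t a b = t%:inum * a + (1 - t%:inum) * b by [].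
have z_gt0 : positive_orthant R n
    (conv t (x : convex_lmodType 'rV[R]_n) y).
  move=> j; have := @convR_gt0 R (x 0 j) (y 0 j) t (x_gt0 j) (y_gt0 j).
  by rewrite zE !mxE.
rewrite !lnE //.
have meanE : (mean_form R n).@[(conv t (x : convex_lmodType 'rV[R]_n) y) 0] =
    conv t ((mean_form R n).@[x 0] : R^o) (mean_form R n).@[y 0].
  rewrite zE convE !meval_mean_form !mulrA -mulrDl !mulr_sumr -big_split /=.
  by congr (_ / _); apply: eq_bigr => j _; rewrite !mxE.
have := concave_ln t (mean_gt0 _ x_gt0) (mean_gt0 _ y_gt0).
rewrite -meanE !convE => /(ler_wpM2l (ler0n R e)) le_e.
apply: le_trans (lerD (lexx (ln c)) le_e).
by rewrite le_eqVlt; apply/orP; left; apply/eqP; ring.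
Qed.

Lemma mean_power_normalized (R : realType) (n : nat) :
  (0 < n)%N -> normalized_at_ones (mean_power R n).
Proof.
move=> n_gt0; have n_neq0 : n%:R != 0 :> R by rewrite pnatr_eq0 -lt0n.
have mean1 : (mean_form R n).@[fun=> 1] = 1.
  by rewrite meval_mean_form sumr_const card_ord divff.
split=> [|i]; first by rewrite rmorphXn /= mean1 expr1n.
by rewrite mderiv_mean_form mevalZ rmorphXn /= mean1 expr1n divff ?mulr1.
Qed.

Lemma mcoeff_mean_power_ones (R : realType) (n : nat) :
  (mean_power R n)@_[multinom 1%N | i < n] = n`!%:R / n%:R ^+ n.
Proof.
set ones := [multinom _ | _ < _].
have deg1 : mdeg ones = n.
  by rewrite mdegE (eq_bigr (fun=> 1%N)) ?sum1_card ?card_ord // => i _; rewrite mnmE.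
have := mcoeff_mderivm ones (mean_power R n) 0%MM.
rewrite addm0 big1 ?mulr1n => [<-|i _]; last by rewrite mnmE.
by rewrite mderivm_mean_form deg1 subnn expr0 ffactnn mcoeffZ mcoeff1 eqxx mulr1.
Qed.

(** * Normalized polynomials *)

(** Euler's identity at the vector of ones, obtained by restricting [p] to the
    line through the origin. *)
Lemma normalized_degree (R : realType) (n d : nat) (p : {mpoly R[n]}) :
  p \is d.-homog -> normalized_at_ones p -> d = n.
Proof.
move=> p_homog [p1 dp1]; pose one : 'rV[R]_n := const_mx 1.
have oneE : one 0 = fun=> 1 by apply: funext => i; rewrite mxE.
have lineE : line_poly p one one = (1 + 'X) ^+ d.
  apply: poly_eq_near0 => t _ _; rewrite horner_line_poly.
  have -> : one + t *: one = (1 + t) *: one by rewrite scalerDl scale1r.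
  by rewrite (meval_homogZ _ _ p_homog) oneE p1 mulr1 horner_exp !hornerE.
have := congr1 (fun g : {poly R} => g^`().[0]) lineE; rewrite /= deriv_line_poly.
rewrite horner_sum (eq_bigr (fun=> 1)) => [|i _]; last first.
  by rewrite hornerZ horner_line_poly scale0r addr0 oneE dp1 mulr1.
rewrite sumr_const card_ord deriv_exp derivD derivX derivC add0r mul1r.
rewrite hornerMn horner_exp hornerD hornerX hornerC addr0 expr1n.
by move=> /eqP; rewrite eqr_nat => /eqP.
Qed.

(** With [x_j = exp y_j], the quotient of [p] by the product of the coordinates
    is the average of [exp (<m, y> - \sum_j y_j)] over the exponents [m], weighted
    by the coefficients of [p]. The normalization says that the weights sum to
    [1] and that the exponent [m] averages to the vector of ones, so the linear
    part of [1 + u <= exp u] averages to [0]. Equality requires [u = 0] for each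
    exponent that occurs. *)
Lemma normalized_prod_le (R : realType) (n : nat) (p : {mpoly R[n]})
    (x : 'rV[R]_n) :
  p \is a mpolyOver n Num.nneg -> normalized_at_ones p ->
  positive_orthant R n x ->
  \prod_j x 0 j <= p.@[x 0] /\
  (p.@[x 0] = \prod_j x 0 j -> forall m, m \in msupp p ->
     \sum_j (m j)%:R * ln (x 0 j) = \sum_j ln (x 0 j)).
Proof.
move=> /mpolyOverP p_ge0 [p1 dp1] x_gt0.
set P := \prod_j _.
pose w (m : 'X_{1..n}) := \sum_j (m j)%:R * ln (x 0 j) - \sum_j ln (x 0 j).
have P_gt0 : 0 < P by apply: prodr_gt0 => j _; apply: x_gt0.
have PE : P = expR (\sum_j ln (x 0 j)).
  by rewrite expR_sum; apply: eq_bigr => j _; rewrite lnK // posrE x_gt0.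
have monomE (m : 'X_{1..n}) : \prod_j x 0 j ^+ m j = P * expR (w m).
  rewrite PE -expRD addrC subrK expR_sum; apply: eq_bigr => j _.
  by rewrite expRM_natl lnK // posrE x_gt0.
have prod1 (m : 'X_{1..n}) : \prod_(k < n) (1 : R) ^+ m k = 1.
  by rewrite big1 // => k _; rewrite expr1n.
have sum1 : \sum_(m <- msupp p) p@_m = 1.
  by rewrite -p1 mevalE; apply: eq_bigr => m _; rewrite prod1 mulr1.
have sumd j : \sum_(m <- msupp p) p@_m * (m j)%:R = 1.
  rewrite -[RHS](dp1 j) [p^`M(j)]/mderiv raddf_sum; apply: eq_bigr => m _ /=.
  by rewrite mevalZ mevalX prod1 mulr1 mulrC.
have sumw : \sum_(m <- msupp p) p@_m * w m = 0.
  under eq_bigr do rewrite mulrBr mulr_sumr.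
  rewrite sumrB exchange_big /= -mulr_suml sum1 mul1r; apply/eqP.
  rewrite subr_eq0; apply/eqP; apply: eq_bigr => j _.
  under eq_bigr do rewrite mulrA.
  by rewrite -mulr_suml sumd mul1r.
have gapE : p.@[x 0] - P = P * \sum_(m <- msupp p) p@_m * (expR (w m) - (1 + w m)).
  under eq_bigr do rewrite mulrBr mulrDr mulr1.
  rewrite sumrB big_split /= sum1 sumw addr0 mulrBr mulr1; congr (_ - _).
  rewrite mevalE mulr_sumr; apply: eq_bigr => m _.
  by rewrite monomE mulrCA.
have term_ge0 m : 0 <= p@_m * (expR (w m) - (1 + w m)).
  by rewrite mulr_ge0 ?subr_ge0 ?expR_ge1Dx // -nnegrE.
split=> [|/eqP].
  by rewrite -subr_ge0 gapE mulr_ge0 ?(ltW P_gt0) // sumr_ge0.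
rewrite -subr_eq0 gapE mulf_eq0 gt_eqF //= psumr_eq0 // => /allP gap0 m m_p.
have := gap0 m m_p; rewrite mulf_eq0 mcoeff_eq0 m_p /= => wE.
apply/eqP; rewrite -subr_eq0; apply: contraTT wE => w_neq0.
by rewrite subr_eq0 gt_eqF // expR_gt1Dx.
Qed.

(** * The equality case *)

(** By homogeneity the value at [axis i] is the leading coefficient of [p] along
    the line. *)
Lemma tight_line_axis (R : realType) (n k : nat) (p : {mpoly R[n]})
    (x : 'rV[R]_n) (i : 'I_n) (r s : R) :
  p \is k.-homog ->
  (forall a, 0 <= a -> p.@[(x + a *: axis i) 0] = (r + s * a) ^+ k) ->
  p.@[(axis i : 'rV[R]_n) 0] = s ^+ k.
Proof.
move=> p_homog formula.
have lineE : line_poly p (axis i) x = (s%:P + r *: 'X) ^+ k.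
  apply: poly_eq_near0 => e e_gt0 _; rewrite horner_line_poly.
  have -> : axis i + e *: x = e *: (x + e^-1 *: axis i).
    by rewrite scalerDr scalerA divff ?gt_eqF // scale1r addrC.
  rewrite (meval_homogZ _ _ p_homog) formula ?invr_ge0 ?ltW // -exprMn.
  rewrite horner_exp hornerD hornerC hornerZ hornerX; congr (_ ^+ _).
  by field; rewrite gt_eqF.
have := congr1 (fun g : {poly R} => g.[0]) lineE.
rewrite /= horner_line_poly scale0r addr0 => ->.
by rewrite horner_exp hornerD hornerC hornerZ hornerX mulr0 addr0.
Qed.

Lemma axis_msupp (R : realType) (n k : nat) (p : {mpoly R[n]}) (i : 'I_n) :
  p \is k.-homog -> p.@[(axis i : 'rV[R]_n) 0] != 0 ->
  (U_(i) *+ k)%MM \in msupp p.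
Proof.
move=> /dhomogP p_homog p_neq0.
have [m m_p mi] : exists2 m, m \in msupp p & forall j, j != i -> m j = 0%N.
  have [/hasP[m m_p /forallP mi]|/hasPn no_m] :=
      boolP (has (fun m : 'X_{1..n} => [forall j, (j != i) ==> (m j == 0%N)])
        (msupp p)).
    by exists m => // j ji; apply/eqP; have /implyP := mi j; apply.
  case/negP: p_neq0; rewrite mevalE big_seq big1 // => m /no_m.
  rewrite negb_forall => /existsP[j]; rewrite negb_imply => /andP[ji mj].
  by rewrite (bigD1 j) //= axisE eq_sym (negbTE ji) expr0n (negbTE mj) mul0r mulr0.
suff <- : m = (U_(i) *+ k)%MM by [].
apply/mnmP => j; rewrite mulmnE mnm1E.
have [<-|ij] := eqVneq i j; last by rewrite mi // eq_sym.
by rewrite -(p_homog m m_p) /= mdegE (bigD1 i) //= big1 ?addn0 ?mul1n.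
Qed.

(** All powers [x_j ^ n] occur in [p], so the equality case of
    [normalized_prod_le] makes [n * ln (m_j)] independent of [j] for the point [m]
    of the tight line: [m] is a multiple of the vector of ones, and so the line
    passes through that vector after rescaling. *)
Lemma tight_line_normalized (R : realType) (k : nat) (p : {mpoly R[k.+1]})
    (i : 'I_k.+1) :
  p \is a mpolyOver k.+1 Num.nneg -> p \is k.+1.-homog ->
  normalized_at_ones p -> (forall j, tight_line k p finset.setT 1 j) ->
  p.@[(axis i : 'rV[R]_k.+1) 0] = k.+1%:R^-1 ^+ k.+1 /\
  forall c, c <= 1 ->
    p.@[(const_mx 1 - c *: axis i) 0] = (1 - c / k.+1%:R) ^+ k.+1.
Proof.
move=> p_ge0 p_homog p_norm tight.
have supp j : (U_(j) *+ k.+1)%MM \in msupp p.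
  have [x [t [s [_ _ s_gt0 _ formula]]]] := tight j.
  apply: axis_msupp => //.
  by rewrite (tight_line_axis p_homog formula) expf_neq0 // gt_eqF.
have [x [t [s [xi t_gt0 s_gt0 ptE formula]]]] := tight i.
have n_gt0 : 0 < k.+1%:R :> R by rewrite ltr0n.
pose m := x + t *: axis i.
have m_gt0 : positive_orthant R k.+1 m.
  by move=> j; have := face_interiorD1 (finset.in_setT i) t_gt0 xi j; rewrite finset.in_setT.
have m_prod : p.@[m 0] = \prod_j m 0 j.
  by rewrite ptE mul1r; apply: eq_bigl => j; rewrite finset.in_setT.
have [_ /(_ m_prod) ln_m] := normalized_prod_le p_ge0 p_norm m_gt0.
have mi : m 0 i = t.
  by have := xi i; rewrite !inE eqxx /= !mxE !eqxx mulr1 => ->; rewrite add0r.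
have ln_mE j : k.+1%:R * ln (m 0 j) = \sum_l ln (m 0 l).
  rewrite -(ln_m _ (supp j)) (bigD1 j) //= big1 => [|l lj].
    by rewrite mulmnE mnm1E eqxx mul1n addr0.
  by rewrite mulmnE mnm1E eq_sym (negbTE lj) mul0r.
have mE j : m 0 j = t.
  rewrite -mi; apply: ln_inj; rewrite ?posrE ?m_gt0 //.
  by apply: (mulfI (lt0r_neq0 n_gt0)); rewrite !ln_mE.
have xE : x = t *: (const_mx 1 - axis i).
  by apply/rowP => j; have := mE j; rewrite !mxE mulrBr mulr1 => /(canRL (addrK _)).
have sE : s = k.+1%:R^-1.
  have := formula t (ltW t_gt0); rewrite -/m m_prod (eq_bigr (fun=> t)) //.
  have -> : k%:R * s * t + s * t = k.+1%:R * s * t by rewrite -natr1 !mulrDl mul1r.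
  rewrite prodr_const card_ord => /eqP.
  rewrite eqrXn2 ?(ltW t_gt0) //; last by rewrite !mulr_ge0 // ltW.
  move/eqP => tE; apply: (mulfI (lt0r_neq0 n_gt0)).
  apply: (mulIf (lt0r_neq0 t_gt0)); rewrite divff ?lt0r_neq0 // mul1r.
  exact: esym tE.
split; first by rewrite (tight_line_axis p_homog formula) sE.
move=> c c_le1.
have -> : const_mx 1 - c *: axis i = t^-1 *: (x + (t * (1 - c)) *: axis i).
  rewrite xE -scalerA -scalerDr scalerA mulVf ?gt_eqF // scale1r.
  by rewrite scalerBl scale1r addrA subrK.
rewrite (meval_homogZ _ _ p_homog) formula; last first.
  by apply: mulr_ge0; [exact: ltW | rewrite subr_ge0].
rewrite -exprMn sE; congr (_ ^+ _).
have nE : k%:R = k.+1%:R - 1 :> R by rewrite -natr1 addrK.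
by rewrite nE; field; rewrite !gt_eqF.
Qed.

Lemma form_root_sum (R : realType) (n d : nat) (p : {mpoly R[n]})
    (I : finType) (y : I -> 'rV[R]_n) :
  strongly_log_concave p -> p \is d.-homog -> (0 < d)%N ->
  (forall i, nonneg_vec (y i)) ->
  \sum_i form_root d p (y i) <= form_root d p (\sum_i y i).
Proof.
move=> p_slc p_homog d_gt0 y_ge0.
pose K (a : R) (z : 'rV[R]_n) := nonneg_vec z /\ a <= form_root d p z.
suff [] : K (\sum_i form_root d p (y i)) (\sum_i y i) by [].
apply: (big_ind2 K) => [|a z b w [z_ge0 az] [w_ge0 bw]|i _].
- by split=> [j|]; rewrite ?mxE ?form_root_ge0.
- split; first exact: nonneg_vecD.
  by apply: le_trans (form_rootD p_slc p_homog d_gt0 z_ge0 w_ge0); apply: lerD.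
- by split.
Qed.

(** The root of [p] equals the mean at the points [axis i] and [1 - c *: axis i].
    Superadditivity applied to the decomposition of [x] along the axes bounds the
    root below by the mean; applied to a decomposition of [n 1] into a small
    multiple of [x] and points on the coordinate lines through [1], it bounds
    the root above by the mean. *)
Lemma tight_normalized_eq (R : realType) (k : nat) (p : {mpoly R[k.+1]}) :
  strongly_log_concave p -> p \is k.+1.-homog ->
  normalized_at_ones p -> (forall j, tight_line k p finset.setT 1 j) ->
  p = mean_power R k.+1.
Proof.
move=> p_slc p_homog p_norm tight; have p_ge0 := slc_nneg p_slc.
have lines i := tight_line_normalized i p_ge0 p_homog p_norm tight.
pose one : 'rV[R]_k.+1 := const_mx 1.
have n_gt0 : 0 < k.+1%:R :> R by rewrite ltr0n.
have n_ge1 : 1 <= k.+1%:R :> R by rewrite ler1n.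
have F_axis i : form_root k.+1 p (axis i) = k.+1%:R^-1.
  by apply: form_root_eq; rewrite ?invr_ge0 //; have [] := lines i.
have F_line i c : c <= 1 ->
    form_root k.+1 p (one - c *: axis i) = 1 - c / k.+1%:R.
  move=> c_le1; apply: form_root_eq => //; last by have [_ ->] := lines i.
  by rewrite subr_ge0 ler_pdivrMr // mul1r (le_trans c_le1).
apply: mpoly_orthant_eq => x x_ge0.
rewrite rmorphXn /= meval_mean_form -(@form_rootK _ _ k.+1) //.
congr (_ ^+ _); apply/eqP; rewrite eq_le; apply/andP; split; last first.
  have {2}-> : x = \sum_i x 0 i *: axis i by rewrite -row_sum_delta.
  have axes_ge0 i : nonneg_vec (x 0 i *: axis i : 'rV[R]_k.+1).
    exact/nonneg_vecZ/nonneg_axis.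
  apply: le_trans (form_root_sum p_slc p_homog isT axes_ge0).
  rewrite mulr_suml ler_sum // => i _.
  by rewrite form_rootZ ?F_axis //; apply: nonneg_axis.
(* Small enough that the points one - (e * x 0 i) *: axis i are nonnegative. *)
pose e := (1 + \sum_i x 0 i)^-1.
have sum_ge0 : 0 <= \sum_i x 0 i by rewrite sumr_ge0.
have e_gt0 : 0 < e by rewrite invr_gt0 ltr_wpDr.
have e_ge0 := ltW e_gt0.
have ex_le1 i : e * x 0 i <= 1.
  rewrite mulrC ler_pdivrMr ?ltr_wpDr // mul1r (bigD1 i) //= addrCA lerDl.
  by rewrite addr_ge0 // sumr_ge0.
have lines_ge0 i : nonneg_vec (one - (e * x 0 i) *: axis i).
  move=> j; rewrite !mxE eqxx /=; case: (j == i); last by rewrite mulr0 subr0.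
  by rewrite mulr1 subr_ge0.
have splitE : k.+1%:R *: one = e *: x + \sum_i (one - (e * x 0 i) *: axis i).
  rewrite sumrB sumr_const card_ord scaler_nat; apply/esym.
  rewrite -[in X in _ + X](eq_bigr _ (fun i _ => scalerA e (x 0 i) (axis i))).
  by rewrite -scaler_sumr -row_sum_delta addrC subrK.
have one_ge0 : nonneg_vec one by move=> j; rewrite mxE.
have F_one : form_root k.+1 p one = 1.
  apply: form_root_eq => //; rewrite expr1n; have [<- _] := p_norm.
  by apply: meval_eq => j; rewrite mxE.
have ex_ge0 := nonneg_vecZ e_ge0 x_ge0.
have slines_ge0 : nonneg_vec (\sum_i (one - (e * x 0 i) *: axis i)).
  by move=> j; rewrite summxE sumr_ge0 // => i _; apply: lines_ge0.
have := form_rootD p_slc p_homog isT ex_ge0 slines_ge0.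
rewrite -splitE !form_rootZ ?F_one // mulr1.
have := form_root_sum p_slc p_homog isT lines_ge0.
rewrite (eq_bigr (fun i => 1 - e * (x 0 i / k.+1%:R))) => [|i _]; last first.
  by rewrite F_line // mulrA.
rewrite sumrB sumr_const card_ord -mulr_sumr -mulr_suml => le1 le2.
rewrite -(ler_pM2l e_gt0).
by move: le2; rewrite -lerBrDr => /le_trans; apply; rewrite lerBlDl -lerBlDr.
Qed.

Theorem theorem1p4 (R : realType) (n : nat) (n_gt0 : (0 < n)%N) :
  [/\ strongly_log_concave (mean_power R n),
      normalized_at_ones (mean_power R n)
    & forall p : {mpoly R[n]},
        strongly_log_concave p -> normalized_at_ones p ->
        let ones := [multinom 1%N | i < n] in
        (mean_power R n)@_ones <= p@_ones /\
        (p@_ones = (mean_power R n)@_ones -> p = mean_power R n)].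
Proof.
split; [exact: mean_power_slc | exact: mean_power_normalized |].
move=> p p_slc p_norm ones; have p_ge0 := slc_nneg p_slc.
have p_homog : p \is n.-homog.
  case: (p_slc) => _ [d p_homog] _.
  by move: p_homog (normalized_degree p_homog p_norm) => + d_n; rewrite d_n.
have onesE : face_monom finset.setT = ones.
  by apply/mnmP => i; rewrite !mnmE finset.in_setT.
have p_ge x : face_interior finset.setT x ->
    1 * \prod_(j in finset.setT) x 0 j <= p.@[x 0].
  move=> xT; rewrite mul1r (eq_bigl xpredT) => [|j]; last exact: finset.in_setT.
  have x_gt0 : positive_orthant R n x by move=> j; have := xT j; rewrite finset.in_setT.
  by have [] := normalized_prod_le p_ge0 p_norm x_gt0.
have [] := face_coeff_bound p_slc p_homog (etrans (cardsT _) (card_ord n))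
  ltr01 p_ge.
have nn_gt0 : 0 < n%:R ^+ n :> R by rewrite exprn_gt0 // ltr0n.
rewrite onesE mcoeff_mean_power_ones mul1r => bound tight.
split=> [|pE]; first by rewrite ler_pdivrMr.
have [|_ lines] := tight; first by rewrite pE divfK ?gt_eqF.
have {}lines i := lines i (finset.in_setT i).
clear - n_gt0 p_slc p_norm p_homog lines.
case: n n_gt0 p p_slc p_norm p_homog lines => // k _ p p_slc p_norm p_homog lines.
exact: tight_normalized_eq.
Qed.
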